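(* The universal$^*$ $R$-matrix $\ddot{R}=\sum_{v\text{ convex}} \frac{P_v\otimes P_{-v}}{z_v}\in U_{q_1,q_2}(\ddot{\mathfrak{gl}}_1)\,\widehat{\otimes}\,U_{q_1,q_2}(\ddot{\mathfrak{gl}}_1)$ of the quantum toroidal algebra of type $\mathfrak{gl}_1$ can be factored as $$\ddot{R}=\prod_{\text{coprime }(a,b)\in(\mathbb{N}\times\mathbb{Z})\sqcup\{(0,1)\}}\exp\left[\sum_{d=1}^\infty\frac{P_{da,db}\otimes P_{-da,-db}}{d}\cdot\frac{q^{\frac d2}-q^{-\frac d2}}{\left(q_1^{\frac d2}-q_1^{-\frac d2}\right)\left(q_2^{\frac d2}-q_2^{-\frac d2}\right)}\right],$$ where $\mathbb{N}=\mathbb{Z}_{>0}$ and the product is taken (from left to right) in increasing order of $\frac ba\in\mathbb{Q}\sqcup\{\infty\}$, the slope of $(0,1)$ being $\infty$.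
   Context: Ground field: $\mathbb{Q}(q_1,q_2)$ with fixed square roots $q_1^{1/2},q_2^{1/2}$ adjoined; $q=q_1q_2$. Half planes: $\mathbb{Z}^2_+=\{(n,m)\in\mathbb{Z}^2: n>0\text{ or }(n=0,\,m>0)\}$ and $\mathbb{Z}^2_-=-\mathbb{Z}^2_+$. The algebra: the quantum toroidal algebra $U_{q_1,q_2}(\ddot{\mathfrak{gl}}_1)$ is identified (Schiffmann's isomorphism) with the elliptic Hall algebra $\mathcal{A}$, generated by $P_{n,m}$, $(n,m)\in\mathbb{Z}^2\setminus\{(0,0)\}$, and central invertible elements $c_1^{\pm1},c_2^{\pm1}$, modulo the following relations. (The Drinfeld-type generators of the toroidal algebra correspond to $e_k=P_{1,k}$, $f_k=P_{-1,k}$, $h_m=P_{0,m}/((q_1^{m/2}-q_1^{-m/2})(q_2^{m/2}-q_2^{-m/2}))$.) (1) If $nm'=n'm$, with $d=\gcd(n,m)$, $$[P_{n,m},P_{n',m'}]=\delta_{n+n'}^0\,\frac{d\,(q_1^{d/2}-q_1^{-d/2})(q_2^{d/2}-q_2^{-d/2})}{q^{-d/2}-q^{d/2}}\,(c_1^nc_2^m-c_1^{-n}c_2^{-m}).$$ (2) If $nm'>n'm$ and the triangle with vertices $(0,0),(n,m),(n+n',m+m')$ contains no lattice points in its interior nor on at least one of its edges (vertices excepted), then, with $d=\gcd(n,m)\gcd(n',m')$, $$[P_{n,m},P_{n',m'}]=\frac{(q_1^{d/2}-q_1^{-d/2})(q_2^{d/2}-q_2^{-d/2})}{q^{-1/2}-q^{1/2}}\,Q_{n+n',m+m'}\cdot\kappa,$$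 where $\kappa=c_1^{-n'}c_2^{-m'}$ if $(n,m)\in\mathbb{Z}^2_\pm$, $(n',m')\in\mathbb{Z}^2_\mp$, $(n+n',m+m')\in\mathbb{Z}^2_\pm$; $\kappa=c_1^nc_2^m$ if $(n,m)\in\mathbb{Z}^2_\pm$, $(n',m')\in\mathbb{Z}^2_\mp$, $(n+n',m+m')\in\mathbb{Z}^2_\mp$; and $\kappa=1$ otherwise. Here, for coprime $a,b$, $\sum_{k\ge0}Q_{ka,kb}x^k=\exp\left[\sum_{k\ge1}\frac{P_{ka,kb}}{k}x^k(q^{k/2}-q^{-k/2})\right]$. Convex paths: a convex path is a finite (possibly empty) sequence $v=\{(n_1,m_1),\dots,(n_t,m_t)\}$ of elements of $\mathbb{Z}^2_+$ with $\frac{m_1}{n_1}\le\dots\le\frac{m_t}{n_t}$ (slope $\infty$ if $n_i=0$), considered up to permuting edges of equal slope. Put $P_{\pm v}=P_{\pm n_1,\pm m_1}\cdots P_{\pm n_t,\pm m_t}$ (well defined by (1)) and $$z_v=v!\prod_{i=1}^t\frac{d_i(q_1^{d_i/2}-q_1^{-d_i/2})(q_2^{d_i/2}-q_2^{-d_i/2})}{q^{d_i/2}-q^{-d_i/2}},\qquad d_i=\gcd(n_i,m_i),$$ where $v!$ is the product of the factorials of the multiplicities with which each vector appears in $v$. Meaning of $\ddot R$: let $\mathcal{A}^{\ge}$ (resp. $\mathcal{A}^{\le}$) be the subalgebra generated by $c_1^{\pm1},c_2^{\pm1}$ and the $P_{n,m}$ with $(n,m)\in\mathbb{Z}^2_+$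 (resp. $\mathbb{Z}^2_-$). $\mathcal{A}$ is a topological bialgebra with $\Delta(c_i)=c_i\otimes c_i$; $\Delta(P_{0,m})=P_{0,m}\otimes1+c_2^m\otimes P_{0,m}$ for $m>0$ and $P_{0,m}\otimes c_2^m+1\otimes P_{0,m}$ for $m<0$; $\Delta(P_{1,k})=P_{1,k}\otimes1+\sum_{m\ge0}c_1c_2^{k-m}\psi_m\otimes P_{1,k-m}$; $\Delta(P_{-1,k})=1\otimes P_{-1,k}+\sum_{m\ge0}P_{-1,k+m}\otimes c_1^{-1}c_2^{k+m}\psi_{-m}$; where $\sum_{m\ge0}\psi_{\pm m}x^m=\exp[\sum_{m\ge1}\frac{P_{0,\pm m}}{m}x^m(q^{m/2}-q^{-m/2})]$. There is a bialgebra pairing $\langle\cdot,\cdot\rangle:\mathcal{A}^\ge\otimes\mathcal{A}^\le\to\mathbb{Q}(q_1,q_2)$ (that is, $\langle aa',b\rangle=\langle a\otimes a',\Delta^{\mathrm{op}}(b)\rangle$ and $\langle a,bb'\rangle=\langle\Delta(a),b\otimes b'\rangle$) such that $c_1,c_2$ pair with everything through the counit and $\langle P_{n,m},P_{n',m'}\rangle=\delta_{n+n'}^0\delta_{m+m'}^0\frac{d(q_1^{d/2}-q_1^{-d/2})(q_2^{d/2}-q_2^{-d/2})}{q^{d/2}-q^{-d/2}}$, $d=\gcd(n,m)$. The elements $P_v$ (resp. $P_{-v}$), $v$ convex, form a basis of $\mathcal{A}^\ge$ (resp. $\mathcal{A}^\le$) over $\mathbb{Q}(q_1,q_2)[c_1^{\pm1},c_2^{\pm1}]$,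 and $\langle P_v,P_{-v'}\rangle=\delta_{v'}^v z_v$. The universal$^*$ $R$-matrix is by definition the corresponding tensor $\ddot R:=\sum_{v\text{ convex}}\frac{P_v\otimes P_{-v}}{z_v}$ in the completed tensor product; it differs from the actual universal $R$-matrix by powers of $q$ involving the central elements. Both sides are formal infinite sums in the completed tensor product $\widehat\otimes$: the ordered infinite product is expanded by choosing a non-constant term from only finitely many of the exponential factors. *)

(* Defs.v *)
From HB Require Import structures.
From mathcomp Require Import all_boot all_order all_algebra fraction.
From mathcomp Require Import generic_quotient ring_quotient.
(* The parsing levels of monalg and mpoly are accepted only before those of
   the files imported next. *)
From mathcomp Require Import monalg mpoly.
From mathcomp Require Import finmap boolp classical_sets constructive_ereal.

Set Implicit Arguments.
Unset Strict Implicit.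
Unset Printing Implicit Defensive.

Import Order.TTheory GRing.Theory Num.Theory.
Local Open Scope ring_scope.
Local Open Scope quotient_scope.
Local Open Scope classical_set_scope.

(* ------------------------------------------------------------------------ *)
(* K-algebras given by generators and relations: the quotient of the free   *)
(* algebra K<G> by the two-sided ideal generated by the l - r, (l, r) in    *)
(* rel.  The ring structure is a pzRingType because nothing prevents the    *)
(* quotient by an arbitrary rel from being the zero ring.                   *)
(* ------------------------------------------------------------------------ *)
Section PresentedAlgebra.
Variables (K : fieldType) (G : choiceType).

Definition freealg := {malg K[{fmonom G}]}.
HB.instance Definition _ := GRing.Lalgebra.on freealg.

Definition freegen (g : G) : freealg := << fmu g >>.

Lemma freealg_comm_scalar (k : K) (x : freealg) : x * k%:A = k%:A * x.
Proof.
rewrite [x]monalgE.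
rewrite mulr_suml mulr_sumr; apply: eq_bigr => m _.
rewrite -!mul_malgC !mulr1.
rewrite !malgM_def !fgmulUU.
by rewrite mulrC mulm1 mul1m.
Qed.

Lemma freealg_scalerAr (k : K) (x y : freealg) : k *: (x * y) = x * (k *: y).
Proof.
by rewrite -[k *: y]mulr_algl mulrA freealg_comm_scalar -mulrA mulr_algl.
Qed.

Variable rel : freealg -> freealg -> Prop.

Inductive rel_ideal : freealg -> Prop :=
| rel_ideal0 : rel_ideal 0
| rel_idealS a l r b z :
    rel l r -> rel_ideal z -> rel_ideal (a * (l - r) * b + z).

Lemma rel_idealD x y : rel_ideal x -> rel_ideal y -> rel_ideal (x + y).
Proof.
elim=> [|a l r b z lr _ IH] hy; first by rewrite add0r.
by rewrite -addrA; apply: rel_idealS => //; apply: IH.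
Qed.

Lemma rel_idealMl c x : rel_ideal x -> rel_ideal (c * x).
Proof.
elim=> [|a l r b z lr _ IH]; first by rewrite mulr0; constructor.
by rewrite mulrDr !mulrA; apply: rel_idealS.
Qed.

Lemma rel_idealMr c x : rel_ideal x -> rel_ideal (x * c).
Proof.
elim=> [|a l r b z lr _ IH]; first by rewrite mul0r; constructor.
by rewrite mulrDl -mulrA; apply: rel_idealS.
Qed.

Lemma rel_idealN x : rel_ideal x -> rel_ideal (- x).
Proof. by rewrite -mulN1r; apply: rel_idealMl. Qed.

Definition rel_idealb : {pred freealg} := fun x => `[< rel_ideal x >].

Lemma rel_idealb_zmod : zmod_closed rel_idealb.
Proof.
split; first by apply/asboolP; constructor.
move=> x y /asboolP hx /asboolP hy; apply/asboolP.
by apply: rel_idealD => //; apply: rel_idealN.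
Qed.

HB.instance Definition _ :=
  GRing.isZmodClosed.Build freealg rel_idealb rel_idealb_zmod.

Definition presalg := {ideal_quot rel_idealb}.
HB.instance Definition _ := GRing.Zmodule.on presalg.
HB.instance Definition _ := EqQuotient.on presalg.

Definition prespi (x : freealg) : presalg := \pi_presalg x.
Definition presgen (g : G) : presalg := prespi (freegen g).

Lemma prespiP x y : prespi x = prespi y <-> rel_ideal (x - y).
Proof.
rewrite /prespi; split=> [/eqP|h].
  by rewrite -Quotient.idealrBE => /asboolP.
by apply/eqP; rewrite -Quotient.idealrBE; apply/asboolP.
Qed.

Lemma prespiK (x : presalg) : prespi (repr x) = x.
Proof. exact: reprK. Qed.

Lemma prespiD x y : prespi (x + y) = prespi x + prespi y.
Proof. exact: Quotient.pi_add. Qed.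

Lemma presalg_ind (P : presalg -> Prop) :
  (forall x, P (prespi x)) -> forall x, P x.
Proof. by move=> h x; rewrite -[x]prespiK. Qed.

Definition presone : presalg := prespi 1.
Definition presmul (x y : presalg) : presalg := prespi (repr x * repr y).
Definition presscale (k : K) (x : presalg) : presalg := prespi (k *: repr x).

Lemma prespiM x y : prespi (x * y) = presmul (prespi x) (prespi y).
Proof.
have hx : rel_ideal (x - repr (prespi x)) by apply/prespiP; rewrite prespiK.
have hy : rel_ideal (y - repr (prespi y)) by apply/prespiP; rewrite prespiK.
apply/prespiP.
rewrite -[x * y](subrK (x * repr (prespi y))) -addrA -mulrBr -mulrBl.
by apply: rel_idealD; [apply: rel_idealMl | apply: rel_idealMr].
Qed.

Lemma prespiZ k x : prespi (k *: x) = presscale k (prespi x).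
Proof.
have hx : rel_ideal (x - repr (prespi x)) by apply/prespiP; rewrite prespiK.
by apply/prespiP; rewrite -scalerBr -mulr_algl; apply: rel_idealMl.
Qed.

Fact presmulA : associative presmul.
Proof.
by elim/presalg_ind=> x; elim/presalg_ind=> y; elim/presalg_ind=> z;
  rewrite -!prespiM mulrA.
Qed.
Fact presmul1l : left_id presone presmul.
Proof. by elim/presalg_ind=> x; rewrite -prespiM mul1r. Qed.
Fact presmul1r : right_id presone presmul.
Proof. by elim/presalg_ind=> x; rewrite -prespiM mulr1. Qed.
Fact presmulDl : left_distributive presmul +%R.
Proof.
by elim/presalg_ind=> x; elim/presalg_ind=> y; elim/presalg_ind=> z;
  rewrite -prespiD -!prespiM -prespiD mulrDl.
Qed.
Fact presmulDr : right_distributive presmul +%R.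
Proof.
by elim/presalg_ind=> x; elim/presalg_ind=> y; elim/presalg_ind=> z;
  rewrite -prespiD -!prespiM -prespiD mulrDr.
Qed.

HB.instance Definition _ := GRing.Zmodule_isPzRing.Build presalg
  presmulA presmul1l presmul1r presmulDl presmulDr.

Fact presscaleA a b x : presscale a (presscale b x) = presscale (a * b) x.
Proof. by elim/presalg_ind: x => x; rewrite -!prespiZ scalerA. Qed.
Fact presscale1 : left_id 1 presscale.
Proof. by elim/presalg_ind=> x; rewrite -prespiZ scale1r. Qed.
Fact presscaleDr : right_distributive presscale +%R.
Proof.
by move=> a; elim/presalg_ind=> x; elim/presalg_ind=> y;
  rewrite -prespiD -!prespiZ -prespiD scalerDr.
Qed.
Fact presscaleDl x : {morph presscale^~ x : a b / a + b}.
Proof.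
by elim/presalg_ind: x => x a b; rewrite -!prespiZ -prespiD scalerDl.
Qed.

HB.instance Definition _ := GRing.Zmodule_isLmodule.Build K presalg
  presscaleA presscale1 presscaleDr presscaleDl.

Lemma presalg_scalerAl (k : K) (x y : presalg) : k *: (x * y) = (k *: x) * y.
Proof.
elim/presalg_ind: x => x; elim/presalg_ind: y => y.
by rewrite -[_ * _]prespiM -[k *: prespi x]prespiZ -[RHS]prespiM
  -[LHS]prespiZ scalerAl.
Qed.

Lemma presalg_scalerAr (k : K) (x y : presalg) : k *: (x * y) = x * (k *: y).
Proof.
elim/presalg_ind: x => x; elim/presalg_ind: y => y.
by rewrite -[_ * _]prespiM -[k *: prespi y]prespiZ -[RHS]prespiM
  -[LHS]prespiZ freealg_scalerAr.
Qed.

Lemma presrelP l r : rel l r -> prespi l = prespi r.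
Proof.
move=> lr; apply/prespiP; rewrite -[l - r]addr0 -[l - r]mul1r -[1 * _]mulr1.
by apply: rel_idealS => //; constructor.
Qed.

End PresentedAlgebra.

(* ------------------------------------------------------------------------ *)
(* The ground field Q(q_1, q_2)(q_1^{1/2}, q_2^{1/2}) is the field of       *)
(* rational functions in two variables, the q_i^{1/2}.                      *)
(* ------------------------------------------------------------------------ *)
Definition ground : fieldType := {fraction (mpoly.mpoly 2 rat)}.

Definition sqrt_q1 : ground :=
  tofrac (mpoly.mpolyX rat (mpoly.mnm1 (ord0 : 'I_2))).
Definition sqrt_q2 : ground :=
  tofrac (mpoly.mpolyX rat (mpoly.mnm1 (ord_max : 'I_2))).
Definition sqrt_q : ground := sqrt_q1 * sqrt_q2.

(* q^{d/2} - q^{-d/2}, for s = q^{1/2} *)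
Definition half_diff (s : ground) (d : nat) : ground := s ^+ d - s ^- d.

Definition alpha (d : nat) : ground :=
  half_diff sqrt_q1 d * half_diff sqrt_q2 d.

Notation Z2 := (int * int)%type.

Definition vgcd (u : Z2) : nat := gcdn `|u.1| `|u.2|.

Definition Zplus (u : Z2) : bool := (0 < u.1) || ((u.1 == 0) && (0 < u.2)).
Definition Zminus (u : Z2) : bool := Zplus (- u).

Definition slope (u : Z2) : \bar rat :=
  if u.1 == 0 then +oo%E else (u.2%:~R / u.1%:~R)%:E.

Definition slope_le (u v : Z2) : bool := (slope u <= slope v)%O.

Definition ratpt (u : Z2) : rat * rat := (u.1%:~R, u.2%:~R).

(* p lies on the segment [a, b], endpoints excepted *)
Definition on_edge (a b p : Z2) : Prop :=
  exists t : rat, [/\ 0 < t, t < 1 &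
    ratpt p = ((1 - t) * (ratpt a).1 + t * (ratpt b).1,
               (1 - t) * (ratpt a).2 + t * (ratpt b).2)].

Definition in_interior (a b c p : Z2) : Prop :=
  exists x y z : rat, [/\ 0 < x, 0 < y, 0 < z, x + y + z = 1 &
    ratpt p = (x * (ratpt a).1 + y * (ratpt b).1 + z * (ratpt c).1,
               x * (ratpt a).2 + y * (ratpt b).2 + z * (ratpt c).2)].

Definition empty_edge (a b : Z2) : Prop := forall p, ~ on_edge a b p.

Definition nice_triangle (a b c : Z2) : Prop :=
  (forall p, ~ in_interior a b c p) /\
  [\/ empty_edge a b, empty_edge b c | empty_edge a c].

(* ------------------------------------------------------------------------ *)
(* The quantum toroidal algebra of gl_1, as the elliptic Hall algebra.      *)
(* The generator inr (i, e) is c_1 (i = false) or c_2 (i = true) when e is  *)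
(* true, and its inverse when e is false.                                   *)
(* ------------------------------------------------------------------------ *)
Definition eha_gen : choiceType := ({u : Z2 | u != 0} + bool * bool)%type.

Notation eha_free := (freealg ground eha_gen).

(* By convention P_{0,0} is 0; it occurs in none of the formulas. *)
Definition ehaP (u : Z2) : eha_free :=
  if insub u is Some u' then freegen ground (inl u' : eha_gen) else 0.

Definition ehac (i e : bool) : eha_free :=
  freegen ground (inr (i, e) : eha_gen).

Definition ehac_pow (i : bool) (n : int) : eha_free :=
  match n with
  | Posz k => ehac i true ^+ k
  | Negz k => ehac i false ^+ k.+1
  end.

(* c_1^n c_2^m for u = (n, m) *)
Definition ehac_mon (u : Z2) : eha_free :=
  ehac_pow false u.1 * ehac_pow true u.2.

(* The coefficient of x^k in exp(\sum_(j >= 1) p_j x^j); powers above the   *)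
(* k-th and terms with j > k do not contribute to it.                       *)
Definition exp_coef (p : nat -> eha_free) (k : nat) : eha_free :=
  \sum_(n < k.+1) (n`!%:R : ground)^-1 *:
    ((\poly_(j < k.+1) (if j == 0%N then 0 else p j)) ^+ n)`_k.

Definition ehaQ (u : Z2) : eha_free :=
  let k := vgcd u in
  let a : Z2 := (divz u.1 k, divz u.2 k) in
  exp_coef (fun j => (half_diff sqrt_q j / j%:R) *: ehaP (a *+ j)) k.

Definition kappa (u v : Z2) : eha_free :=
  if [|| [&& Zplus u, Zminus v & Zplus (u + v)]
       | [&& Zminus u, Zplus v & Zminus (u + v)]] then ehac_mon (- v)
  else if [|| [&& Zplus u, Zminus v & Zminus (u + v)]
            | [&& Zminus u, Zplus v & Zplus (u + v)]] then ehac_mon u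
  else 1.

Inductive eha_rel : eha_free -> eha_free -> Prop :=
| eha_c_inv i : eha_rel (ehac i true * ehac i false) 1
| eha_inv_c i : eha_rel (ehac i false * ehac i true) 1
| eha_central i g :
    eha_rel (ehac i true * freegen ground g) (freegen ground g * ehac i true)
(* The central term is present only if (n, m) + (n', m') = 0; for n <> 0    *)
(* this amounts to n + n' = 0.                                              *)
| eha_parallel (u v : Z2) :
    u != 0 -> v != 0 -> u.1 * v.2 = v.1 * u.2 ->
    eha_rel (ehaP u * ehaP v - ehaP v * ehaP u)
      (if u + v == 0 then
         ((vgcd u)%:R * alpha (vgcd u) / - half_diff sqrt_q (vgcd u)) *:
           (ehac_mon u - ehac_mon (- u))
       else 0)
| eha_triangle (u v : Z2) :
    u != 0 -> v != 0 -> v.1 * u.2 < u.1 * v.2 -> nice_triangle 0 u (u + v) ->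
    eha_rel (ehaP u * ehaP v - ehaP v * ehaP u)
      ((alpha (vgcd u * vgcd v) / - half_diff sqrt_q 1) *:
         (ehaQ (u + v) * kappa u v)).

Definition qtor := presalg eha_rel.

Definition qP (u : Z2) : qtor := prespi eha_rel (ehaP u).
Definition c_mon (u : Z2) : qtor := prespi eha_rel (ehac_mon u).

(* ------------------------------------------------------------------------ *)
(* The algebra qtor (x) qtor.  The tens_rel reduce every word in the pure   *)
(* tensors to a linear combination of pure tensors, subject to bilinearity. *)
(* ------------------------------------------------------------------------ *)
Notation tens_free := (freealg ground (qtor * qtor)%type).
Notation ftens a b := (freegen ground ((a, b) : (qtor * qtor)%type)).

Inductive tens_rel : tens_free -> tens_free -> Prop :=
| tensDl a a' b : tens_rel (ftens (a + a') b) (ftens a b + ftens a' b)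
| tensDr a b b' : tens_rel (ftens a (b + b')) (ftens a b + ftens a b')
| tensZl k a b : tens_rel (ftens (k *: a) b) (k *: ftens a b)
| tensZr k a b : tens_rel (ftens a (k *: b)) (k *: ftens a b)
| tens1 : tens_rel (ftens 1 1) 1
| tensM a a' b b' :
    tens_rel (ftens a b * ftens a' b') (ftens (a * a') (b * b')).

Definition qtor2 := presalg tens_rel.

Definition tens (a b : qtor) : qtor2 :=
  presgen tens_rel ((a, b) : (qtor * qtor)%type).

Definition halfplane : choiceType := {u : Z2 | Zplus u}.

Definition is_convex (v : seq halfplane) : bool :=
  sorted (relpre val slope_le) v.

Definition convex_seq : choiceType := {v : seq halfplane | is_convex v}.

(* A permutation between two sequences of nondecreasing slope only permutes *)
(* edges of equal slope.                                                    *)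
Definition convex_eq (v w : convex_seq) : bool := perm_eq (val v) (val w).

Lemma convex_eq_equiv : equiv_class_of convex_eq.
Proof.
split=> [v|v w|w v x]; rewrite /convex_eq ?perm_refl //.
  by rewrite perm_sym.
by move=> vw wx; apply: perm_trans wx.
Qed.

Canonical convex_equiv := EquivRelPack convex_eq_equiv.
Canonical convex_encModRel := defaultEncModRel convex_eq.

Definition cpath := {eq_quot convex_eq}.
HB.instance Definition _ := Choice.on cpath.

Definition edges (v : cpath) : seq halfplane := val (repr v).

Definition Ppos (v : cpath) : qtor := \prod_(e <- edges v) qP (val e).
Definition Pneg (v : cpath) : qtor := \prod_(e <- edges v) qP (- val e).

Definition path_fact (v : cpath) : nat :=
  \prod_(e <- undup (edges v)) (count_mem e (edges v))`!.

Definition z_ (v : cpath) : ground :=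
  (path_fact v)%:R *
  \prod_(e <- edges v)
    ((vgcd (val e))%:R * alpha (vgcd (val e)) /
       half_diff sqrt_q (vgcd (val e))).

(* ------------------------------------------------------------------------ *)
(* The completed tensor product: the completion of qtor (x) qtor in which   *)
(* arbitrary infinite combinations of the tensors                           *)
(*   (P_v x P_{-w}) (x) (P_v' x' P_{-w'})                                   *)
(* are allowed, for x, x' monomials in c_1^{+-1}, c_2^{+-1} (the elements   *)
(* P_v P_{-w} form a basis of qtor over the Laurent polynomials in c_1 and  *)
(* c_2).  A fundamental system of neighbourhoods of 0 consists of the spans *)
(* of all such tensors except those whose label ((v, w), (v', w')) lies in  *)
(* a given finite set, and a point of the completion is a compatible family *)
(* of cosets of these subspaces.                                            *)
(* ------------------------------------------------------------------------ *)
Definition pbw (v w : cpath) (k : Z2) : qtor := Ppos v * c_mon k * Pneg w.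

Definition tlabel : choiceType := ((cpath * cpath) * (cpath * cpath))%type.

Definition pbw_tens_out (F : {fset tlabel}) : set qtor2 :=
  [set y | exists (l : tlabel) (k k' : Z2),
     l \notin F /\ y = tens (pbw l.1.1 l.1.2 k) (pbw l.2.1 l.2.2 k')].

Definition linspan (X : set qtor2) : set qtor2 :=
  [set y | exists r : seq (ground * qtor2),
     (forall p, p \in r -> X p.2) /\ y = \sum_(p <- r) p.1 *: p.2].

Definition nbhd0 (F : {fset tlabel}) : set qtor2 := linspan (pbw_tens_out F).

Lemma nbhd00 F : nbhd0 F 0.
Proof. by exists [::]; rewrite big_nil. Qed.

Lemma nbhd0D F x y : nbhd0 F x -> nbhd0 F y -> nbhd0 F (x + y).
Proof.
move=> [r [hr ->]] [r' [hr' ->]]; exists (r ++ r'); rewrite big_cat; split=> //.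
by move=> p; rewrite mem_cat => /orP[/hr|/hr'].
Qed.

Lemma nbhd0Z F k x : nbhd0 F x -> nbhd0 F (k *: x).
Proof.
move=> [r [hr ->]]; exists [seq (k * p.1, p.2) | p <- r]; split.
  move=> q /mapP[p pr qE]; rewrite qE /=; exact: hr.
by rewrite big_map scaler_sumr; apply: eq_bigr => p _; rewrite scalerA.
Qed.

Lemma nbhd0N F x : nbhd0 F x -> nbhd0 F (- x).
Proof. by move=> hx; rewrite -scaleN1r; apply: nbhd0Z. Qed.

Lemma nbhd0S F F' : (F `<=` F')%fset -> nbhd0 F' `<=` nbhd0 F.
Proof.
move=> FF' x [r [hr ->]]; exists r; split=> // p /hr [l [k [k' [lF ->]]]].
by exists l, k, k'; split=> //; apply: contra lF => /(fsubsetP FF').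
Qed.

Record hat_qtor2 := HatQtor2 {
  coset_at : {fset tlabel} -> set qtor2;
  coset_atP : forall F, exists a : qtor2, coset_at F = [set x | nbhd0 F (x - a)];
  coset_at_compat : forall F F', (F `<=` F')%fset ->
    coset_at F' `<=` coset_at F
}.

Definition hat_of_coset (a : qtor2) (F : {fset tlabel}) : set qtor2 :=
  [set x | nbhd0 F (x - a)].

Fact hat_of_cosetP a F :
  exists b, hat_of_coset a F = [set x | nbhd0 F (x - b)].
Proof. by exists a. Qed.

Fact hat_of_compat a F F' : (F `<=` F')%fset ->
  hat_of_coset a F' `<=` hat_of_coset a F.
Proof. by move=> FF' x; apply: nbhd0S. Qed.

Definition hat_of (a : qtor2) : hat_qtor2 :=
  HatQtor2 (hat_of_cosetP a) (@hat_of_compat a).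

(* Unconditional summation in the completion. *)
Definition sums_to (I : choiceType) (t : I -> qtor2) (x : hat_qtor2) : Prop :=
  forall F, exists I0 : {fset I}, forall I1 : {fset I},
    (I0 `<=` I1)%fset -> coset_at x F (\sum_(i <- I1) t i).

Definition hat_summable (I : choiceType) (t : I -> qtor2) : Prop :=
  exists x, sums_to t x.

Lemma sums_to_inj (I : choiceType) (t : I -> qtor2) x y :
  sums_to t x -> sums_to t y -> x = y.
Proof.
have sub (x' y' : hat_qtor2) : sums_to t x' -> sums_to t y' ->
    forall F, coset_at x' F `<=` coset_at y' F.
  move=> tx ty F b; have [I0 hx] := tx F; have [I1 hy] := ty F.
  have := hx _ (fsubsetUl I0 I1); have := hy _ (fsubsetUr I0 I1).
  have [u ->] := coset_atP x' F; have [v ->] := coset_atP y' F => /=.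
  move: (\sum_(i <- _) _) => s sv su bu.
  have -> : b - v = (b - u) - (s - u) + (s - v).
    by rewrite opprB !subrKA.
  by apply: nbhd0D => //; apply: nbhd0D => //; apply: nbhd0N.
move=> tx ty; have: coset_at x = coset_at y.
  by apply/funext => F; apply/seteqP; split; apply: sub.
case: x tx => cx px qx tx; case: y ty => cy py qy ty /= e.
by subst cy; congr HatQtor2; apply: Prop_irrelevance.
Qed.

(* The value 0 for families that are not summable is junk. *)
Definition hat_sum (I : choiceType) (t : I -> qtor2) : hat_qtor2 :=
  if pselect (hat_summable t) is left h then projT1 (cid h) else hat_of 0.

Lemma hat_sumP (I : choiceType) (t : I -> qtor2) :
  hat_summable t -> sums_to t (hat_sum t).
Proof.
by rewrite /hat_sum; case: pselect => // h _; case: (cid h).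
Qed.

Definition R_term (v : cpath) : qtor2 :=
  (z_ v)^-1 *: tens (Ppos v) (Pneg v).

Definition Rddot : hat_qtor2 := hat_sum R_term.

Definition coprime_dir : choiceType :=
  {u : Z2 | ((0 < u.1) && coprimez u.1 u.2) || (u == (0, 1))}.

(* The terms of exp[\sum_(d >= 1) y_d] = \sum_n (\sum_d y_d)^n / n!,        *)
(* indexed by the finite sequences js, with d = j + 1 for j in js; the      *)
(* constant term 1 has index [::].                                          *)
Definition exp_term (y : nat -> qtor2) (js : seq nat) : qtor2 :=
  ((size js)`!%:R : ground)^-1 *: \prod_(j <- js) y j.+1.

Definition expansion : choiceType :=
  {fsfun coprime_dir -> seq nat with [::]}.

(* The terms of the expansion of the product of the exp[\sum_d y_{s,d}] in  *)
(* increasing order of the slope of s: a term is chosen in each factor, all *)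
(* but finitely many of them being the constant term.                       *)
Definition exp_prod_term (y : coprime_dir -> nat -> qtor2)
    (f : expansion) : qtor2 :=
  \prod_(s <- sort (relpre val slope_le) (finsupp f)) exp_term (y s) (f s).

Definition exp_prod (y : coprime_dir -> nat -> qtor2) : hat_qtor2 :=
  hat_sum (exp_prod_term y).

(* Main.v *)
(* Expanding the product picks, for finitely many coprime directions s, a word
   (j_1, ..., j_k) weighted by 1/k!; since (s, d) |-> d s is a bijection onto the
   half plane, these choices are exactly the ordered versions of convex paths,
   and parallel edges commute by relation (1).  A convex path v whose edges in
   direction s form the multiset M_s therefore arises from the
   \prod_s (|M_s|! / \prod_j (mult. of j in M_s)!) choices of orderings, which
   together with the weights \prod_s 1/|M_s|! produces exactly the 1/v! of 1/z_v.
   Both sums converge, to the same point of the completion, because all terms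
   attached to v are multiples of one tensor, whose label determines v. *)
Require Import Defs.
From mathcomp Require Import all_boot all_order all_algebra fraction.
From mathcomp Require Import generic_quotient mpoly.
From mathcomp Require Import finmap boolp classical_sets constructive_ereal.
From mathcomp Require Import zify.

Set Implicit Arguments.
Unset Strict Implicit.
Unset Printing Implicit Defensive.

Import Order.TTheory GRing.Theory Num.Theory.
Local Open Scope ring_scope.
Local Open Scope quotient_scope.
Local Open Scope classical_set_scope.

(** * Counting orderings, products along sorted sequences, and finite families of choices *)

Lemma sum_count_undup (T : eqType) (s : seq T) :
  (\sum_(x <- undup s) count_mem x s = size s)%N.
Proof.
rewrite -sum1_size -[RHS]big_undup_iterop_count; apply: eq_bigr => x _.
by rewrite Monoid.iteropE iter_addn_0 mul1n.
Qed.

(** The multinomial formula, by induction on the length through the first letter of an ordering. [U]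
    may exceed the support of [s], so that it stays fixed when a letter disappears from
    [rem x s]. *)
Lemma size_permutations_count (T : eqType) (U s : seq T) :
  uniq U -> {subset s <= U} ->
  (size (permutations s) * \prod_(x <- U) (count_mem x s)`! = (size s)`!)%N.
Proof.
move=> uU; have [n] := ubnP (size s); elim: n s => // n IHn s; rewrite ltnS.
have [->|s0] := eqVneq s [::].
  by move=> *; rewrite big1_seq.
move=> sn sU; have s_gt0 : (0 < size s)%N by rewrite lt0n size_eq0.
rewrite (perm_size (permutationsE s_gt0)) size_allpairs_dep sumnE big_map.
rewrite big_distrl -(prednK s_gt0) factS prednK //.
(* Splitting the factor [size s] of the factorial into multiplicities matches it with the sum over
   first letters [x]. *)
rewrite -[X in (X * _`!)%N]sum_count_undup big_distrl big_seq [RHS]big_seq /=; apply: eq_bigr => x.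
rewrite mem_undup => xs; rewrite -(size_rem xs).
rewrite -(IHn (rem x s)); last first.
- by move=> y /mem_rem /sU.
- by rewrite size_rem //; case: (size s) s_gt0 sn.
rewrite mulnCA; congr muln; rewrite !(bigD1_seq x (sU _ xs) uU) /=.
rewrite mulnA count_rem xs /= eqxx subn1.
have c0 : (0 < count_mem x s)%N by rewrite -has_count has_pred1.
congr muln; first by case: (count_mem x s) c0 => // m _; rewrite factS.
by apply: eq_bigr => y /negPf yx; rewrite count_rem xs /= eq_sym yx subn0.
Qed.

(** For a preorder, two sorted arrangements differ only inside classes of equivalent elements. The
    head [a] of [A] is pulled to the front of [B]: whatever precedes it there lies above [a] because
    [A] is sorted and below [a] because [B] is, hence commutes with it. *)
Lemma big_sorted_perm (T : eqType) (R : pzRingType) (le : rel T) (F : T -> R)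
    (A B : seq T) :
  transitive le ->
  (forall x y, le x y -> le y x -> F x * F y = F y * F x) ->
  sorted le A -> sorted le B -> perm_eq A B ->
  \prod_(x <- A) F x = \prod_(x <- B) F x.
Proof.
move=> trle comm; elim: A B => [|a A IH] B sA sB AB.
  by move: AB; rewrite perm_sym => /perm_nilP ->.
have aB : a \in B by rewrite -(perm_mem AB) mem_head.
have [B1 [B2 eB]] : exists B1 B2, B = B1 ++ a :: B2.
  by case/splitPr: aB => B1 B2; exists B1, B2.
subst B.
have AB12 : perm_eq A (B1 ++ B2).
  by rewrite -(perm_cons a) (perm_trans AB) // -[a :: B2]cat1s perm_catCA.
rewrite big_cons (IH (B1 ++ B2)) //; first last.
- apply: (subseq_sorted trle _ sB).
  by rewrite cat_subseq // subseq_cons.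
- by move: sA => /= /path_sorted.
rewrite !big_cat big_cons /= !mulrA; congr (_ * _).
have B1a x : x \in B1 -> F a * F x = F x * F a.
  move=> xB1; apply: comm.
    move: sA => /=; rewrite (path_sortedE trle) => /andP[/allP + _]; apply.
    by rewrite (perm_mem AB12) mem_cat xB1.
  move: sB; rewrite (sorted_pairwise trle) pairwise_cat.
  by case/and3P => /allrelP + _ _; apply; rewrite ?mem_head.
elim: B1 B1a {sA sB AB AB12 IH aB} => [|b B1 IH] h.
  by rewrite big_nil mulr1 mul1r.
rewrite big_cons mulrA h ?mem_head // -!mulrA IH // => x xB1.
by apply: h; rewrite inE xB1 orbT.
Qed.

(** Serves to enumerate the expansions that yield a given path: the keys are directions, and [L]
    lists the admissible words in each of them. *)
Lemma fsfun_choices (K V : choiceType) (d : V) (L : K -> seq V) (D : seq K) :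
  uniq D -> (forall k, uniq (L k)) ->
  exists E : seq {fsfun K -> V with d}, [/\ uniq E,
    size E = (\prod_(k <- D) size (L k))%N &
    forall f, f \in E <->
      forall k, if k \in D then f k \in L k else f k == d].
Proof.
move=> + uL; elim: D => [_|k D IH /= /andP[kD /IH [E [uE sE mE]]]].
  exists [:: [fsfun]]; split; rewrite ?big_nil // => f; rewrite inE.
  split=> [/eqP -> k|h]; first by rewrite fsfunE /=.
  by apply/eqP/fsfunP => k; rewrite fsfunE; apply/eqP; exact: (h k).
pose upd v (f : {fsfun K -> V with d}) : {fsfun K -> V with d} :=
  [fsfun f with k |-> v].
have updE v f x : upd v f x = if x == k then v else f x by rewrite fsfun_withE.
exists [seq upd v f | v <- L k, f <- E]; split.
- apply: allpairs_uniq => // -[v f] [w g] /=.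
  move=> /allpairsP[[a b] /= [_ bE [-> ->]]] /allpairsP[[a' b'] /= [_ bE' [-> ->]]].
  move=> /fsfunP e; congr (_, _); first by have := e k; rewrite !updE eqxx.
  apply/fsfunP => x; have := e x; rewrite !updE; case: eqP => // -> _.
  have /mE/(_ k) := bE; have /mE/(_ k) := bE'.
  by rewrite (negPf kD) => /eqP -> /eqP ->.
- by rewrite size_allpairs big_cons sE.
move=> f; split.
  move=> /allpairsP[[v g] /= [vL /mE gE ->]] x; rewrite updE inE.
  by case: eqP => [->|_] //=; apply: gE.
move=> h; apply/allpairsP.
(* Resetting [f] at [k] to the default gives a member of the smaller family, because [k] is not in
   [D]. *)
exists (f k, upd d f).
split=> /=; first by have := h k; rewrite mem_head.
  apply/mE => x; rewrite updE; have := h x; rewrite inE.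
  by case: eqP => [->|_] //=; rewrite ?(negPf kD).
by apply/fsfunP => x; rewrite !updE; case: eqP => [->|].
Qed.

(** * Products in the presented algebras and commuting generators *)

Lemma prespi_mul (K : fieldType) (G : choiceType)
    (rel : freealg K G -> freealg K G -> Prop) x y :
  prespi rel x * prespi rel y = prespi rel (x * y).
Proof. by rewrite prespiM. Qed.

Lemma prespi_comm (K : fieldType) (G : choiceType)
    (rel : freealg K G -> freealg K G -> Prop) x y :
  rel (x * y - y * x) 0 ->
  prespi rel x * prespi rel y = prespi rel y * prespi rel x.
Proof.
by move=> /presrelP/prespiP; rewrite subr0 !prespi_mul => h; apply/prespiP.
Qed.

Lemma qP_comm (u v : Z2) :
  u != 0 -> v != 0 -> u + v != 0 -> u.1 * v.2 = v.1 * u.2 ->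
  qP u * qP v = qP v * qP u.
Proof.
move=> u0 v0 uv0 uv; apply: prespi_comm.
by have := eha_parallel u0 v0 uv; rewrite (negPf uv0).
Qed.

Lemma tens_mul (a a' b b' : qtor) :
  tens a b * tens a' b' = tens (a * a') (b * b').
Proof. by rewrite /tens /presgen prespi_mul; apply: presrelP; constructor. Qed.

Lemma tens_prod (I : Type) (r : seq I) (f g : I -> qtor) :
  \prod_(i <- r) tens (f i) (g i) =
  tens (\prod_(i <- r) f i) (\prod_(i <- r) g i).
Proof.
elim: r => [|i r IH]; last by rewrite !big_cons IH tens_mul.
by rewrite !big_nil; apply/esym/presrelP/tens1.
Qed.

Lemma presalg_scaler_prod (K : fieldType) (G : choiceType)
    (rel : freealg K G -> freealg K G -> Prop) (I : Type) (r : seq I)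
    (k : I -> K) (x : I -> presalg rel) :
  \prod_(i <- r) (k i *: x i) = (\prod_(i <- r) k i) *: \prod_(i <- r) x i.
Proof.
elim: r => [|i r IH]; first by rewrite !big_nil scale1r.
rewrite !big_cons IH; set kr := bigop _ _ _; set xr := bigop _ _ _.
apply: etrans (esym (presalg_scalerAl (k i) (x i) (kr *: xr))) _.
apply: etrans (scalerA (k i) kr (x i * xr)).
exact/congr1/esym/presalg_scalerAr.
Qed.

Lemma natr_ground_neq0 n : (0 < n)%N -> (n%:R : ground) != 0.
Proof.
rewrite lt0n -tofrac1 -tofracMn tofrac_eq0 => n0.
by rewrite -mpolyC_nat mpolyC_eq0 pnatr_eq0.
Qed.

(** * Slopes and the half plane *)

Lemma slope_mulrn (u : Z2) n : slope (u *+ n.+1) = slope u.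
Proof.
case: u => a b; rewrite /slope pairMnE /= mulrn_eq0 /=; case: eqP => // _.
have -> // : (b *+ n.+1)%:~R / (a *+ n.+1)%:~R = b%:~R / a%:~R :> rat.
rewrite -(mulr_natr b) -(mulr_natr a) !intrM -mulf_div divff ?mulr1 //.
by rewrite intr_eq0 pnatr_eq0.
Qed.

Lemma slope_eq_cross (u v : Z2) :
  slope u = slope v -> u.1 * v.2 = v.1 * u.2.
Proof.
rewrite /slope; case: eqP => [->|/eqP u0]; case: eqP => [->|/eqP v0] //.
  by rewrite !mul0r.
case=> /eqP; rewrite eqr_div ?intr_eq0 // -!rmorphM /= => /eqP/intr_inj e.
by rewrite mulrC -e mulrC.
Qed.

Lemma slope_le_trans : transitive slope_le.
Proof. by move=> v u w; apply: le_trans. Qed.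

Lemma slope_le_total : total slope_le.
Proof. by move=> u v; apply: le_total. Qed.

Lemma ZplusD (u v : Z2) : Zplus u -> Zplus v -> Zplus (u + v).
Proof. by case: u v => [a b] [c d]; rewrite /Zplus /=; lia. Qed.

Lemma Zplus_neq0 (u : Z2) : Zplus u -> u != 0.
Proof. by apply: contraTneq => ->. Qed.

(** Equal slopes make relation (1) applicable, and its central term is absent because the half plane
    is closed under addition and omits 0. *)
Lemma qP_comm_slope (u v : halfplane) :
  slope_le (val u) (val v) -> slope_le (val v) (val u) ->
  qP (val u) * qP (val v) = qP (val v) * qP (val u) /\
  qP (- val u) * qP (- val v) = qP (- val v) * qP (- val u).
Proof.
case: u v => [u pu] [v pv] /= uv vu.
have cross := slope_eq_cross (le_anti (introT andP (conj uv vu))).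
have u0 := Zplus_neq0 pu; have v0 := Zplus_neq0 pv.
have uv0 := Zplus_neq0 (ZplusD pu pv).
by split; apply: qP_comm; rewrite -?opprD ?oppr_eq0 //= !mulrNN.
Qed.

(** * The half plane as coprime directions times positive integers *)

Lemma coprime_dirP (s : coprime_dir) :
  coprime `|(val s).1| `|(val s).2| /\ Zplus (val s).
Proof.
case: s => -[a b] /= /orP[/andP[a0]|/eqP[-> ->]] //.
by rewrite coprimezE /Zplus /= a0.
Qed.

Lemma vgcd_mulrn (s : coprime_dir) n : vgcd (val s *+ n) = n.
Proof.
have [+ _] := coprime_dirP s; case: (val s) => a b /= /eqP co.
rewrite /vgcd pairMnE /= -(mulr_natr a) -(mulr_natr b) !natz !abszM !absz_nat.
by rewrite -muln_gcdl co mul1n.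
Qed.

Lemma Zplus_mulrn (u : Z2) n : Zplus u -> Zplus (u *+ n.+1).
Proof.
move=> pu; elim: n => [|n IH]; first by rewrite mulr1n.
by rewrite mulrS; apply: ZplusD.
Qed.

(** The index j stands for d = j + 1, as in [exp_term]. *)
Definition edge (p : coprime_dir * nat) : halfplane :=
  Sub (val p.1 *+ p.2.+1) (Zplus_mulrn p.2 (coprime_dirP p.1).2).

Lemma edge_inj : injective edge.
Proof.
move=> [s i] [t j] /(congr1 val) /= e.
have ij : i = j by apply: succn_inj; rewrite -[LHS](vgcd_mulrn s) e vgcd_mulrn.
congr (_, _) => //; apply: val_inj; move: e; rewrite {}ij.
case: s t => [[a b] ps] [[c d] pt] /=; rewrite !pairMnE /= => -[/eqP + /eqP].
by rewrite !eqrMn2r /= => /eqP -> /eqP ->.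
Qed.

Lemma edge_surj (u : halfplane) : exists p, edge p = u.
Proof.
case: u => -[a b] pu; set g := gcdn `|a| `|b|.
have g0 : (0 < g)%N by rewrite gcdn_gt0 !absz_gt0; move: pu; rewrite /Zplus /=; lia.
have /dvdzP[a' ea] : (g %| a)%Z by rewrite dvdzE dvdn_gcdl.
have /dvdzP[b' eb] : (g %| b)%Z by rewrite dvdzE dvdn_gcdr.
have co : coprime `|a'| `|b'|.
  have e c' : (`|c'| * g)%N = `|(c' * g)%R|%N by rewrite abszM absz_nat.
  by rewrite /coprime -(eqn_pmul2r g0) mul1n muln_gcdl !e -ea -eb.
have dirP : ((0 < a') && coprimez a' b') || ((a', b') == (0, 1)).
  rewrite coprimezE co andbT; move: pu; rewrite /Zplus /= ea eb.
  rewrite !pmulr_lgt0 ?ltz_nat // mulf_eq0 => /orP[->//|/andP[a0 b0]].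
  (* In the vertical case [a'] is 0, and coprimality with [b'] positive forces [b'] to be 1. *)
  move: co b0 a0; case: (a' =P 0) => [->|//] /=; last first.
    by move=> _ _ _; rewrite eqz_nat; case: (g) g0.
  by rewrite /coprime gcd0n; case: b' {eb} => // n /eqP ->.
exists (Sub (a', b') dirP : coprime_dir, g.-1); apply: val_inj => /=.
by rewrite prednK // pairMnE /= -(mulr_natr a') -(mulr_natr b') natz ea eb.
Qed.

Lemma edge_bij : bijective edge.
Proof.
have [g gK] := choice edge_surj.
by exists g => // p; apply: edge_inj; rewrite gK.
Qed.

(** * Sorting pairs by their first component *)

Section Slices.
Variables (S T : eqType).
Implicit Types (A B : seq (S * T)) (s : S).

Definition slice A s : seq T := [seq p.2 | p <- A & p.1 == s].

Lemma count_slice A s (j : T) : count_mem j (slice A s) = count_mem (s, j) A.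
Proof.
rewrite count_map count_filter; apply: eq_count => -[s' j'] /=.
by rewrite xpair_eqE andbC.
Qed.

Lemma perm_sliceP A B :
  (forall s, perm_eq (slice A s) (slice B s)) <-> perm_eq A B.
Proof.
split=> [h|AB s]; last by apply/perm_map/perm_filter.
by apply/allP => -[s j] _ /=; rewrite -!count_slice; apply/eqP/permP/h.
Qed.

Lemma slice_allpairs (D : seq S) (h : S -> seq T) s : uniq D ->
  slice [seq (s', j) | s' <- D, j <- h s'] s = if s \in D then h s else [::].
Proof.
have slice1 s' l : slice [seq (s', j) | j <- l] s = if s == s' then l else [::].
  by rewrite /slice eq_sym; elim: l => [|j l /=] //=; case: eqP => //= _ ->.
elim: D => //= s' D IH /andP[s'D uD].
rewrite /slice filter_cat map_cat -!/(slice _ _) slice1 IH // inE.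
by case: eqP => //= ->; rewrite (negPf s'D) cats0.
Qed.

Lemma perm_undup_slices A :
  perm_eq (undup A)
    [seq (s, j) | s <- undup (unzip1 A), j <- undup (slice A s)].
Proof.
apply: uniq_perm; first exact: undup_uniq.
  apply: allpairs_uniq_dep => [|s _|[s j] [s' j'] _ _ /=]; rewrite ?undup_uniq //.
  by case=> -> ->.
move=> [s j]; rewrite mem_undup; apply/idP/allpairsPdep => [sA|].
  exists s, j; rewrite !mem_undup; split=> //.
    by apply/mapP; exists (s, j).
  by apply/mapP; exists (s, j); rewrite ?mem_filter /= ?eqxx.
move=> [s' [j' [_ + [-> ->]]]].
rewrite mem_undup => /mapP[[s1 j1]]; rewrite mem_filter => /andP[/eqP /= <-].
by move=> ? ->.
Qed.

Lemma slice_neq0 A s : (slice A s != [::]) = (s \in unzip1 A).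
Proof.
rewrite -size_eq0 size_map size_filter -lt0n -has_count.
apply/hasP/mapP => [[p pA /eqP <-]|[p pA ->]]; first by exists p.
by exists p => /=.
Qed.

End Slices.

(** The multinomial formula in each direction, multiplied over all directions: the multiplicity of j
    in the slice at s is that of (s, j) in [A]. *)
Lemma prod_size_permutations_slices (S T : eqType) (A : seq (S * T)) :
  ((\prod_(s <- undup (unzip1 A)) size (permutations (slice A s))) *
     \prod_(p <- undup A) (count_mem p A)`! =
   \prod_(s <- undup (unzip1 A)) (size (slice A s))`!)%N.
Proof.
rewrite (perm_big _ (perm_undup_slices A)) big_allpairs_dep -big_split /=.
apply: eq_bigr => s _.
under [X in (_ * X)%N]eq_bigr do rewrite -count_slice.
by apply: size_permutations_count => [|j]; rewrite ?undup_uniq ?mem_undup.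
Qed.

(** * Summation by finite fibres in the completion *)

Lemma sum_fibers (V : zmodType) (I J : choiceType) (t : I -> V) (t' : J -> V)
    (phi : J -> I) (fib : I -> {fset J}) (S : {fset I}) (J1 : {fset J}) :
  (forall i j, j \in fib i <-> phi j = i) ->
  (forall i, t i = \sum_(j <- fib i) t' j) ->
  (forall i, i \in S -> (fib i `<=` J1)%fset) ->
  \sum_(j <- J1) t' j - \sum_(i <- S) t i =
  \sum_(j <- J1 | phi j \notin S) t' j.
Proof.
move=> fibP tE sub; apply/eqP; rewrite subr_eq addrC.
rewrite (bigID (fun j => phi j \in S)) /=.
apply/eqP; congr (_ + _).
(* As [J1] contains the whole fibre over each point of [S], its part over [S] is a union of complete
   fibres. *)
have -> : \sum_(i <- S) t i = \sum_(i <- S) \sum_(j <- J1 | phi j == i) t' j.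
  rewrite big_seq [RHS]big_seq; apply: eq_bigr => i iS.
  rewrite tE -[RHS]big_filter; apply: perm_big; apply: uniq_perm => //.
    exact: filter_uniq.
  move=> j; rewrite mem_filter.
  apply/idP/andP => [/[dup] /fibP /eqP jP ji|[/eqP/fibP //]].
  by split=> //; apply: (fsubsetP (sub i iS)).
rewrite (exchange_big_dep predT) //= big_mkcond; apply: eq_bigr => j _.
case: ifP => jS; last by rewrite big1_seq // => i /andP[/eqP <-]; rewrite jS.
rewrite big_mkcond (bigD1_seq (phi j)) //= eqxx big1 ?addr0 // => i.
by rewrite eq_sym => /negPf ->.
Qed.

Lemma nbhd0_sum F (I : eqType) (r : seq I) (P : pred I) (t : I -> qtor2) :
  (forall i, P i -> nbhd0 F (t i)) -> nbhd0 F (\sum_(i <- r | P i) t i).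
Proof.
by move=> h; apply: big_rec => [|i x Pi]; [apply: nbhd00|apply/nbhd0D/h].
Qed.

(** The common limit is built by hand: modulo [nbhd0 F] only the indices over the finite set [S F]
    count, so its coset at [F] is that of the partial sum over [S F]. *)
Lemma sums_to_fibers (I J : choiceType) (t : I -> qtor2) (t' : J -> qtor2)
    (phi : J -> I) (fib : I -> {fset J}) (S : {fset tlabel} -> {fset I}) :
  (forall i j, j \in fib i <-> phi j = i) ->
  (forall i, t i = \sum_(j <- fib i) t' j) ->
  (forall F i, i \notin S F -> nbhd0 F (t i)) ->
  (forall F j, phi j \notin S F -> nbhd0 F (t' j)) ->
  exists x, sums_to t x /\ sums_to t' x.
Proof.
move=> fibP tE tS t'S.
pose a F := \sum_(i <- S F) t i.
have near_a F (I1 : {fset I}) : (S F `<=` I1)%fset ->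
    nbhd0 F (\sum_(i <- I1) t i - a F).
  move=> SI; rewrite (@sum_fibers _ _ _ t t id (fun i => [fset i]%fset)).
  - by apply: nbhd0_sum => i; apply: tS.
  - by move=> i j; rewrite inE; split=> [/eqP|->].
  - by move=> i; rewrite big_seq_fset1.
  - by move=> i iS; rewrite fsub1set (fsubsetP SI).
pose C F : set qtor2 := [set x | nbhd0 F (x - a F)].
have CP F : exists b, C F = [set x | nbhd0 F (x - b)] by exists (a F).
(* [S] is not assumed monotone, so the two partial sums are compared through the one over the union
   of [S F] and [S F']. *)
have Ccompat F F' : (F `<=` F')%fset -> C F' `<=` C F.
  move=> FF' x; rewrite /C /= => xF'.
  have h := near_a F _ (fsubsetUl (S F) (S F')).
  have h' := near_a F' _ (fsubsetUr (S F) (S F')).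
  have -> : x - a F = (x - a F') - (\sum_(i <- (S F `|` S F')%fset) t i - a F') +
      (\sum_(i <- (S F `|` S F')%fset) t i - a F).
    by rewrite opprB !subrKA.
  apply: nbhd0D h; apply: (nbhd0S FF').
  by apply: nbhd0D => //; apply: nbhd0N.
exists (HatQtor2 CP Ccompat); split=> F.
  by exists (S F) => I1; apply: near_a.
exists (\bigcup_(i <- S F) fib i)%fset => J1 SJ /=.
rewrite /C /a /= (sum_fibers (phi := phi) (fib := fib)) //.
  by apply: nbhd0_sum => j; apply: t'S.
by move=> i iS; apply: fsubset_trans SJ; apply: bigfcup_sup.
Qed.

(** * From terms of the expanded product to convex paths *)

Definition dirs (f : expansion) : seq coprime_dir :=
  sort (relpre val slope_le) (finsupp f).

Definition choices (f : expansion) : seq (coprime_dir * nat) :=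
  [seq (s, j) | s <- dirs f, j <- f s].

Definition path_edges (f : expansion) : seq halfplane := map edge (choices f).

Lemma uniq_dirs f : uniq (dirs f).
Proof. by rewrite sort_uniq. Qed.

Lemma mem_dirs f s : (s \in dirs f) = (f s != [::]).
Proof. by rewrite mem_sort mem_finsupp. Qed.

Lemma slice_choices f s : slice (choices f) s = f s.
Proof.
rewrite slice_allpairs ?uniq_dirs // mem_dirs.
by case: eqVneq.
Qed.

Lemma halfplane_slope_le_trans :
  transitive (relpre (val : halfplane -> Z2) slope_le).
Proof. by move=> v u w; apply: slope_le_trans. Qed.

Lemma path_edges_convex f : is_convex (path_edges f).
Proof.
rewrite /is_convex sorted_map /choices.
have : sorted (relpre val slope_le) (dirs f).
  by apply: sort_sorted => s s'; apply: slope_le_total.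
have tr (T : Type) (h : T -> Z2) : transitive (relpre h slope_le).
  by move=> v u w; apply: slope_le_trans.
rewrite !sorted_pairwise; [|exact: (tr _ (val \o edge))|exact: tr].
have edgeE s j s' j' :
    slope_le (val (edge (s, j))) (val (edge (s', j'))) = slope_le (val s) (val s').
  by rewrite /slope_le !slope_mulrn.
elim: (dirs f) => //= s D IH /andP[sD /IH IHD].
rewrite pairwise_cat IHD andbT; apply/andP; split.
  apply/allrelP => _ _ /mapP[j _ ->] /allpairsPdep[s' [j' [s'D _ ->]]].
  by rewrite /= edgeE; move/allP: sD; apply.
rewrite pairwise_map; elim: (f s) => //= j l ->; rewrite andbT.
by apply/allP => j' _ /=; rewrite edgeE /slope_le.
Qed.

Definition path_of (f : expansion) : cpath :=
  \pi_cpath (Sub (path_edges f) (path_edges_convex f) : convex_seq).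

Lemma perm_edges_pi (w : convex_seq) : perm_eq (edges (\pi_cpath w)) (val w).
Proof.
rewrite /edges; have /eqmodP : \pi_cpath (repr (\pi_cpath w)) = \pi_cpath w.
  by rewrite reprK.
by [].
Qed.

Lemma path_ofP f v : path_of f = v <-> perm_eq (path_edges f) (edges v).
Proof.
split=> [<-|h]; first by rewrite perm_sym perm_edges_pi.
by rewrite -[v]reprK; apply/eqmodP.
Qed.

(** The representative chosen by [edges] may order parallel edges differently from [path_edges f];
    this is harmless when they commute. *)
Lemma path_prod (F : halfplane -> qtor) f :
  (forall e e' : halfplane, slope_le (val e) (val e') ->
     slope_le (val e') (val e) -> F e * F e' = F e' * F e) ->
  \prod_(e <- path_edges f) F e = \prod_(e <- edges (path_of f)) F e.
Proof.
move=> comm; apply: (big_sorted_perm halfplane_slope_le_trans comm).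
- exact: path_edges_convex.
- exact: (valP (repr (path_of f))).
- exact/path_ofP.
Qed.

(** The scalar in front of one tensor of the exponent; it is also the reciprocal of the factor of
    z_v at [edge p], whose gcd is [p.2.+1]. *)
Definition edge_coef (p : coprime_dir * nat) : ground :=
  p.2.+1%:R^-1 *
  (half_diff sqrt_q p.2.+1 / (half_diff sqrt_q1 p.2.+1 * half_diff sqrt_q2 p.2.+1)).

Definition expansion_coef (f : expansion) : ground :=
  \prod_(s <- dirs f) ((size (f s))`!%:R)^-1 * \prod_(p <- choices f) edge_coef p.

Definition Rfactor (s : coprime_dir) (d : nat) : qtor2 :=
  (d%:R^-1 * (half_diff sqrt_q d /
              (half_diff sqrt_q1 d * half_diff sqrt_q2 d))) *:
    tens (qP (val s *+ d)) (qP (- (val s *+ d))).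

Lemma exp_prod_termE f :
  exp_prod_term Rfactor f =
  expansion_coef f *: tens (Ppos (path_of f)) (Pneg (path_of f)).
Proof.
have -> : Ppos (path_of f) = \prod_(e <- path_edges f) qP (val e).
  by apply/esym/path_prod => e e' h h'; exact: (proj1 (qP_comm_slope h h')).
have -> : Pneg (path_of f) = \prod_(e <- path_edges f) qP (- val e).
  by apply/esym/path_prod => e e' h h'; exact: (proj2 (qP_comm_slope h h')).
rewrite /expansion_coef /path_edges !big_map !big_allpairs_dep -big_split /=.
rewrite -tens_prod -presalg_scaler_prod.
apply: eq_bigr => s _; rewrite /exp_term -tens_prod -scalerA.
by rewrite -presalg_scaler_prod.
Qed.

(** * Comparison of the coefficients with 1/z_v *)

Lemma path_fact_map (v : cpath) (A : seq (coprime_dir * nat)) :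
  edges v = map edge A ->
  path_fact v = (\prod_(p <- undup A) (count_mem p A)`!)%N.
Proof.
move=> vA; rewrite /path_fact vA undup_map_inj; last exact: edge_inj.
rewrite big_map; apply: eq_bigr => p _; rewrite count_map; congr _`!.
by apply: eq_count => p' /=; rewrite (inj_eq edge_inj).
Qed.

Lemma z_invE (v : cpath) (A : seq (coprime_dir * nat)) :
  edges v = map edge A ->
  (z_ v)^-1 =
  (\prod_(p <- undup A) (count_mem p A)`!)%N%:R^-1 * \prod_(p <- A) edge_coef p.
Proof.
move=> vA; rewrite /z_ invfM (path_fact_map vA) vA big_map; congr (_ * _).
rewrite -prodfV; apply: eq_bigr => p _.
by rewrite vgcd_mulrn invf_div /edge_coef /alpha invfM mulrCA.
Qed.

(** The expansions giving [v] are the choices of one ordering of each slice of its edges. They all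
    contribute the same multiple of one tensor, so only their number matters. *)
Lemma path_fiber (v : cpath) : exists fib : {fset expansion},
  (forall f, f \in fib <-> path_of f = v) /\
  R_term v = \sum_(f <- fib) exp_prod_term Rfactor f.
Proof.
have [g gK eK] := edge_bij; pose A := map g (edges v).
have vA : edges v = map edge A by rewrite mapK.
pose D := undup (unzip1 A); pose L s := permutations (slice A s).
have [E [uE sE mE]] := @fsfun_choices _ _ [::] L D (undup_uniq _)
  (fun s => permutations_uniq _).
have EP f : f \in E <-> perm_eq (choices f) A.
  rewrite mE -perm_sliceP; split=> h s; have := h s; rewrite slice_choices.
    rewrite mem_undup -slice_neq0 mem_permutations.
    by case: eqVneq => [->|_] //= /eqP ->.
  rewrite mem_undup -slice_neq0 mem_permutations.
  by case: eqVneq => [->|_] //= /perm_nilP ->.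
have pathE f : path_of f = v <-> perm_eq (choices f) A.
  rewrite path_ofP vA; split=> [|h]; last exact: perm_map.
  exact: (perm_map_inj edge_inj).
exists [fset f in E]%fset; split=> [f|]; first by rewrite inE /= EP pathE.
pose c := \prod_(s <- D) ((size (slice A s))`!%:R : ground)^-1 *
  \prod_(p <- A) edge_coef p.
have -> : \sum_(f <- [fset f in E]%fset) exp_prod_term Rfactor f =
    \sum_(f <- E) c *: tens (Ppos v) (Pneg v).
  rewrite (perm_big E) /=; last first.
    by apply: uniq_perm => [||f]; rewrite ?fset_uniq ?inE.
  rewrite big_seq [RHS]big_seq; apply: eq_bigr => f /EP fA.
  have fv := (pathE f).2 fA; rewrite exp_prod_termE fv.
  suff -> : expansion_coef f = c by [].
  rewrite /expansion_coef (perm_big _ fA); congr (_ * _).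
  have fs s : perm_eq (f s) (slice A s).
    by rewrite -slice_choices; apply: (perm_sliceP _ _).2.
  under eq_bigr => s _ do rewrite (perm_size (fs s)).
  apply: perm_big; apply: uniq_perm; rewrite ?uniq_dirs ?undup_uniq // => s.
  rewrite mem_dirs mem_undup -slice_neq0.
  by rewrite -!size_eq0 (perm_size (fs s)).
rewrite big_const_seq count_predT iter_addr_0 -scaler_nat scalerA.
pose m := (\prod_(p <- undup A) (count_mem p A)`!)%N.
have m0 : (m%:R : ground) != 0.
  by apply/natr_ground_neq0/prodn_gt0 => p; apply: fact_gt0.
rewrite /R_term (z_invE vA) -/m.
suff -> : m%:R^-1 * \prod_(p <- A) edge_coef p = (size E)%:R * c by [].
(* Once multiplied by v!, here [m], the claim is the count of orderings of the slices. *)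
rewrite /c mulrA; congr (_ * _); apply: (mulIf m0).
rewrite mulVf // mulrAC -natrM sE prod_size_permutations_slices prodfV -natr_prod.
by apply/esym/mulfV/natr_ground_neq0/prodn_gt0 => s; apply: fact_gt0.
Qed.

(** * Convergence of both sums to the same point *)

Definition no_edges : cpath := \pi_cpath (Sub [::] isT : convex_seq).

Lemma edges_no_edges : edges no_edges = [::].
Proof. by apply/perm_nilP; apply: perm_edges_pi. Qed.

(** The label of the tensor of P_v and P_{-v}, which have trivial negative and positive parts
    respectively. *)
Definition diag_label (v : cpath) : tlabel := ((v, no_edges), (no_edges, v)).

(** The first entry of the diagonal label recovers [v], so a finite [F] can obstruct only finitely
    many paths. *)
Lemma diag_tens_nbhd0 (F : {fset tlabel}) (k : ground) (v : cpath) :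
  v \notin [fset l.1.1 | l in F]%fset ->
  nbhd0 F (k *: tens (Ppos v) (Pneg v)).
Proof.
move=> vF; apply: nbhd0Z; exists [:: (1, tens (Ppos v) (Pneg v))].
split; last by rewrite big_seq1 scale1r.
move=> p; rewrite inE => /eqP -> /=; exists (diag_label v), 0, 0; split.
  by apply: contra vF => vF; apply/imfsetP; exists (diag_label v).
have c0 : c_mon 0 = 1 by rewrite /c_mon /ehac_mon /= !expr0 mulr1.
have P0 : Ppos no_edges = 1 by rewrite /Ppos edges_no_edges big_nil.
have N0 : Pneg no_edges = 1 by rewrite /Pneg edges_no_edges big_nil.
rewrite /pbw /= c0 P0 N0; congr (tens _ _); apply/esym.
  exact: etrans (mulr1 _) (mulr1 _).
exact: etrans (congr1 ( *%R^~ _) (mulr1 _)) (mul1r _).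
Qed.

Theorem theorem1p1 :
  let y (s : coprime_dir) (d : nat) : qtor2 :=
    (d%:R^-1 * (half_diff sqrt_q d /
                (half_diff sqrt_q1 d * half_diff sqrt_q2 d))) *:
      tens (qP (val s *+ d)) (qP (- (val s *+ d))) in
  [/\ hat_summable R_term,
      hat_summable (exp_prod_term y) &
      Rddot = exp_prod y].
Proof.
move=> y; have [fib fibP] := choice path_fiber.
have [x [Rx Ex]] : exists x, sums_to R_term x /\ sums_to (exp_prod_term y) x.
  apply: (@sums_to_fibers _ _ R_term (exp_prod_term y) path_of fib
    (fun F => [fset l.1.1 | l in F]%fset)) => [v f|v|F v vF|F f fF].
  - exact: (fibP v).1.
  - exact: (fibP v).2.
  - exact: diag_tens_nbhd0.
  - by rewrite exp_prod_termE; apply: diag_tens_nbhd0.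
have hR : hat_summable R_term by exists x.
have hE : hat_summable (exp_prod_term y) by exists x.
split=> //; rewrite /Rddot /exp_prod.
by rewrite (sums_to_inj (hat_sumP hR) Rx) (sums_to_inj (hat_sumP hE) Ex).
Qed.
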